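(* Let $m$ be a positive even integer, $k,i$ positive integers, $s,u$ integers, $Q=2^{m}+1$, $K=2^{k}$. Assume $v_{2}(k) \leq v_{2}(m)$, $\gcd(i,Q)=1$, $\gcd(K+2s+1,Q)=1$, and $\gcd(d_{1},2^{2m}-1)=1$, where $d_{1}=(K+2s+1)i+uQ$, $d_{2}=(K+2s+1)i+uQ+(Q-2)i$, $d_{3}=(K+2s+1)i+uQ+(Q-2)si$, $d_{4}=(K+2s+1)i+uQ+(Q-2)(s+1)i$, $d_{5}=(K+2s+1)i+uQ+(Q-2)2si$, $d_{6}=(K+2s+1)i+uQ+(Q-2)(2s+1)i$, $d_{7}=(K+2s+1)i+uQ+(Q-2)(K+1)i$, $d_{8}=(K+2s+1)i+uQ+(Q-2)(K+s+1)i$, $d_{9}=(K+2s+1)i+uQ+(Q-2)(K+2s+1)i$. Then $\sum_{j=1}^{9}x^{d_{j}}$ is a permutation polynomial over $\mathbb{F}_{2^{2m}}$.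
   Context: $v_2(\cdot)$ denotes the 2-adic valuation. A polynomial $f$ is a permutation polynomial over $\mathbb{F}_{q}$ if $x\mapsto f(x)$ is a bijection of $\mathbb{F}_q$. Integer exponents are understood modulo $2^{2m}-1=Q(Q-2)$, i.e. $x^{d}$ means $x^{d \bmod (2^{2m}-1)}$. *)

(* Defs.v *)
From mathcomp Require Import all_boot all_order all_algebra.

Set Implicit Arguments.
Unset Strict Implicit.
Unset Printing Implicit Defensive.

Import GRing.Theory.
Local Open Scope ring_scope.

Definition permutation_polynomial (F : finFieldType) (f : {poly F}) : Prop :=
  bijective (fun x : F => f.[x]).

(* For N > 0, (d %% N)%Z is the representative of d in {0, ..., N - 1}, so the
   absolute value only converts it to a nat.  When N divides d, the result is
   'X^0 = 1, whose value at 0 is 1. *)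
Definition Xmod (F : finFieldType) (N d : int) : {poly F} :=
  'X^(absz (d %% N)%Z).

(* Main.v *)
Require Import Defs.
From mathcomp Require Import all_boot all_order all_algebra finfield.
From mathcomp Require Import ring zify.

(* Put q = 2^m.  On nonzero x the polynomial is x^d1 D(y) (y^{2s} + y^s + 1)
   with y = x^{(q-1)i} in the group of (q+1)-st roots of unity and
   D(y) = y^{K+1} + y + 1; its q-th power is obtained by replacing D(y) with
   M(y) = y^{K+1} + y^K + 1.  Hence its value determines M(y)/D(y), and
   everything reduces to the injectivity of M/D on the (q+1)-st roots of unity,
   since then gcd(i, q+1) = gcd(d1, q^2-1) = 1 recover x.
   Let w be a primitive cube root of unity; it lies in F_q because m is even.
   In the coordinate t(y) = (y + w)/(y + w^2), the fraction M/D is the power map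
   t |-> w t^{K+1} (k odd) or w t^{1-K} (k even).  The ratio r of two values of
   t with the same image satisfies r^q = r^-1 and r^K = r or r^-1, which forces
   r = 1 as v_2(k) <= v_2(m). *)

Set Implicit Arguments.
Unset Strict Implicit.
Unset Printing Implicit Defensive.

Import Order.TTheory GRing.Theory Num.Theory.
Local Open Scope ring_scope.

(** * Powers in fields and Frobenius iteration in characteristic 2 *)

Lemma expfz_gcd_inj (F : fieldType) (x y : F) (a b : int) :
  x != 0 -> y != 0 -> gcdz a b = 1 -> x ^ a = y ^ a -> x ^ b = y ^ b -> x = y.
Proof.
move=> x0 y0 ab xya xyb; have [c [d cd]] := Bezoutz a b.
by rewrite -[x]expr1z -[y]expr1z -ab -cd !expfzDr // (mulrC c) (mulrC d)
  -!exprz_exp xya xyb.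
Qed.

Lemma expf_coprime_eq1 (F : fieldType) (r : F) (a b : nat) :
  coprime a b -> r ^+ a = 1 -> r ^+ b = 1 -> r = 1.
Proof.
case: a => [|a]; first by rewrite /coprime gcd0n => /eqP ->.
move=> ab ra rb; apply: (@expfz_gcd_inj _ _ _ a.+1 b).
- by apply: contra_eq_neq ra => ->; rewrite expr0n eq_sym oner_eq0.
- exact: oner_neq0.
- by rewrite /gcdz /= (eqP ab).
- by rewrite -exprnP ra exp1rz.
- by rewrite -exprnP rb exp1rz.
Qed.

Lemma expr_iter_fixed (R : pzSemiRingType) (r : R) (n j : nat) :
  r ^+ n = r -> r ^+ (n ^ j) = r.
Proof. by move=> rn; elim: j => // j IHj; rewrite expnSr exprM IHj. Qed.

Lemma expr_iter_inv (F : fieldType) (r : F) (n j : nat) :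
  r ^+ n = r^-1 -> odd j -> r ^+ (n ^ j) = r^-1.
Proof.
move=> rn oddj.
suff -> : r ^+ (n ^ j) = if odd j then r^-1 else r by rewrite oddj.
elim: j {oddj} => // j IHj; rewrite expnSr exprM IHj /=.
by case: (odd j); rewrite /= ?exprVn rn ?invrK.
Qed.

Lemma sqrf_eq1_pchar2 (F : fieldType) (r : F) :
  2%N \in [pchar F] -> r ^+ 2 = 1 -> r = 1.
Proof. by move=> ch2 /eqP; rewrite sqrf_eq1 oppr_pchar2 // orbb => /eqP. Qed.

(* Write [n = 2^a n'] and [m = 2^b m'] with [n'], [m'] odd: since [a <= b], the
   number [m n'] is a multiple of [n], so iterating Frobenius [m n'] times
   both fixes [r] and, as [n'] is odd, inverts it. *)
Lemma frobenius_fixed_inv_eq1 (F : fieldType) (r : F) (m n : nat) :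
  2%N \in [pchar F] -> (0 < m)%N -> (0 < n)%N -> (logn 2 n <= logn 2 m)%N ->
  r != 0 -> r ^+ (2 ^ n) = r -> r ^+ (2 ^ m) = r^-1 -> r = 1.
Proof.
move=> ch2 m0 n0 vnm r0 rn rm; apply: sqrf_eq1_pchar2 => //.
have [n' odd_n' En] := pfactor_coprime (isT : prime 2) n0.
have [m' _ Em] := pfactor_coprime (isT : prime 2) m0.
have Enm : (m * n' = n * (m' * 2 ^ (logn 2 m - logn 2 n)))%N.
  have Eab : (2 ^ logn 2 m = 2 ^ (logn 2 m - logn 2 n) * 2 ^ logn 2 n)%N.
    by rewrite -expnD subnK.
  move: Em En Eab; set p := (2 ^ logn 2 n)%N; set p' := (2 ^ logn 2 m)%N.
  by set c := (2 ^ _)%N => -> -> ->; ring.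
have rV : r^-1 = r.
  rewrite -[LHS](expr_iter_inv (j := n') rm); last by rewrite -coprime2n.
  by rewrite -expnM Enm expnM expr_iter_fixed.
by rewrite expr2 -{1}rV mulVf.
Qed.

Lemma exprDn_pchar2 (R : comNzSemiRingType) (x y : R) (n : nat) :
  2%N \in [pchar R] -> (x + y) ^+ (2 ^ n) = x ^+ (2 ^ n) + y ^+ (2 ^ n).
Proof. by move=> ch2; rewrite exprDn_pchar // pnatX pnatE // ch2. Qed.

Lemma expfS_eq1_inv (F : fieldType) (y : F) (n : nat) :
  y ^+ n.+1 = 1 -> y ^+ n = y^-1.
Proof. by rewrite exprS => /mulr1_eq. Qed.

Lemma expfS_eq1_neq0 (F : fieldType) (y : F) (n : nat) :
  y ^+ n.+1 = 1 -> y != 0.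
Proof. by apply: contra_eq_neq => ->; rewrite expr0n eq_sym oner_eq0. Qed.

(** * Cube roots of unity and nonvanishing on the (q+1)-st roots of unity *)

Lemma cube_eq1 (R : comPzRingType) (w : R) :
  w ^+ 2 + w + 1 = 0 -> w ^+ 3 = 1.
Proof.
move=> hw; apply/eqP; rewrite -subr_eq0.
have -> : w ^+ 3 - 1 = (w - 1) * (w ^+ 2 + w + 1) by ring.
by rewrite hw mulr0.
Qed.

Lemma modn3_exp2 (m : nat) : (2 ^ m %% 3 = if odd m then 2 else 1)%N.
Proof.
by elim: m => // m IHm; rewrite expnS -modnMmr IHm /=; case: (odd m).
Qed.

(** A root would have [y ^+ 3 = 1]; for even [m], 3 is coprime to [2 ^ m + 1], so [y = 1], where the
    value is 1 in characteristic 2. *)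
Lemma cyclotomic3_neq0 (F : fieldType) (y : F) (m : nat) :
  2%N \in [pchar F] -> ~~ odd m -> y ^+ (2 ^ m).+1 = 1 ->
  y ^+ 2 + y + 1 != 0.
Proof.
move=> ch2 evm yQ; apply/eqP => hy; have y3 := cube_eq1 hy.
have y1 : y = 1.
  apply: expf_coprime_eq1 y3 yQ; rewrite prime_coprime // /dvdn -addn1 -modnDml.
  by rewrite modn3_exp2 (negbTE evm).
by move/eqP: hy; rewrite y1 expr1n addrr_pchar2 // add0r oner_eq0.
Qed.

(** The q-th power map inverts [a] and [y]; for [a] = y^K this links D to M. *)
Lemma numer_denom_frobenius (F : fieldType) (a y : F) (m : nat) :
  2%N \in [pchar F] -> a ^+ (2 ^ m).+1 = 1 -> y ^+ (2 ^ m).+1 = 1 ->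
  (a * y + y + 1) ^+ (2 ^ m) = (a * y)^-1 * (a * y + a + 1).
Proof.
move=> ch2 aQ yQ; rewrite !exprDn_pchar2 // exprMn expr1n.
rewrite (expfS_eq1_inv aQ) (expfS_eq1_inv yQ).
by field; rewrite (expfS_eq1_neq0 aQ) (expfS_eq1_neq0 yQ).
Qed.

(** If D vanishes, so does its q-th power, hence M. Subtracting gives y^K = y, and D becomes y^2 + y
    + 1. *)
Lemma denom_neq0 (F : fieldType) (y : F) (m k : nat) :
  2%N \in [pchar F] -> ~~ odd m -> y ^+ (2 ^ m).+1 = 1 ->
  y ^+ (2 ^ k) * y + y + 1 != 0.
Proof.
set a := y ^+ (2 ^ k) => ch2 evm yQ; apply/eqP => D0.
have aQ : a ^+ (2 ^ m).+1 = 1 by rewrite exprAC yQ expr1n.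
have /eqP := numer_denom_frobenius ch2 aQ yQ; rewrite D0 expr0n expn_eq0 /=.
rewrite eq_sym mulf_eq0 invr_eq0 mulf_eq0.
rewrite (negPf (expfS_eq1_neq0 aQ)) (negPf (expfS_eq1_neq0 yQ)) /= => /eqP N0.
have ay : a = y.
  apply/eqP; rewrite -subr_eq0; apply/eqP.
  by rewrite -[RHS](subrr 0) -{1}N0 -D0; ring.
by have := cyclotomic3_neq0 ch2 evm yQ; rewrite expr2 -{1}ay D0 eqxx.
Qed.

(** * The fraction M/D in the coordinate t *)

Lemma exp2n_omega (F : fieldType) (w : F) (j : nat) :
  w ^+ 3 = 1 -> w ^+ (2 ^ j) = if odd j then w ^+ 2 else w.
Proof.
by move=> w3; rewrite -(expr_mod _ w3) modn3_exp2; case: (odd j).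
Qed.

(** Together with its companion for [w ^+ 2], this makes (M + w D)/(M + w^2 D) equal to w t(y) (a +
    w^2)/(a + w). *)
Lemma numer_add_omega_denom (R : comNzRingType) (w a y : R) :
  2%N \in [pchar R] -> w ^+ 2 = w + 1 ->
  (a * y + a + 1) + w * (a * y + y + 1) = w ^+ 2 * ((a + w ^+ 2) * (y + w)).
Proof.
move=> ch2 hw; have h2 : 2 = 0 :> R := pcharf0 ch2.
(* [ring] does not know the characteristic, so the discrepancy is written out as a multiple of 2. *)
have -> : (a * y + a + 1) + w * (a * y + y + 1) =
  w ^+ 2 * ((a + w ^+ 2) * (y + w)) - 2 * (a * w + (w + 1) * y + 2 * w + 1).
  by ring: hw.
by rewrite h2 mul0r subr0.
Qed.

Lemma numer_add_omega2_denom (R : comNzRingType) (w a y : R) :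
  2%N \in [pchar R] -> w ^+ 2 = w + 1 ->
  (a * y + a + 1) + w ^+ 2 * (a * y + y + 1) = w * ((a + w) * (y + w ^+ 2)).
Proof.
move=> ch2 hw; have h2 : 2 = 0 :> R := pcharf0 ch2.
have -> : (a * y + a + 1) + w ^+ 2 * (a * y + y + 1) =
  w * ((a + w) * (y + w ^+ 2)) + 2 * (a * y - a * w - w).
  by ring: hw.
by rewrite h2 mul0r addr0.
Qed.

Lemma numer_denom_inj (F : fieldType) (w y z : F) (m k : nat) :
  let a := y ^+ (2 ^ k) in let b := z ^+ (2 ^ k) in
  2%N \in [pchar F] -> w ^+ 2 = w + 1 ->
  ~~ odd m -> (0 < m)%N -> (0 < k)%N -> (logn 2 k <= logn 2 m)%N ->
  y ^+ (2 ^ m).+1 = 1 -> z ^+ (2 ^ m).+1 = 1 ->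
  (a * y + a + 1) * (b * z + z + 1) = (b * z + b + 1) * (a * y + y + 1) ->
  y = z.
Proof.
move=> a b ch2 hw evm m0 k0 vkm yQ zQ hND.
have w210 : w ^+ 2 + w + 1 = 0 by rewrite hw -addrA addrr_pchar2.
have w3 := cube_eq1 w210.
have w0 := expfS_eq1_neq0 w3.
have wm : w ^+ (2 ^ m) = w by rewrite exp2n_omega // (negPf evm).
have w2m : (w ^+ 2) ^+ (2 ^ m) = w ^+ 2 by rewrite exprAC wm.
have Pneq0 t : t ^+ (2 ^ m).+1 = 1 -> (t + w != 0) && (t + w ^+ 2 != 0).
  move=> tQ; rewrite -negb_or -mulf_eq0.
  suff -> : (t + w) * (t + w ^+ 2) = t ^+ 2 + t + 1.
    exact: cyclotomic3_neq0 tQ.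
  have -> : (t + w) * (t + w ^+ 2) = t ^+ 2 + t + 1 + 2 * (w * (t + 1)).
    by ring: hw.
  by rewrite (pcharf0 ch2) mul0r addr0.
have /andP[Py Py2] := Pneq0 y yQ; have /andP[Pz Pz2] := Pneq0 z zQ.
have hPQ : ((a + w ^+ 2) * (y + w)) * ((b + w) * (z + w ^+ 2)) =
           ((b + w ^+ 2) * (z + w)) * ((a + w) * (y + w ^+ 2)).
  (* With this factor both sides become products of some M + w D and some M + w^2 D; they differ by
     w^2 - w times the difference in [hND]. *)
  apply: (mulfI (_ : w ^+ 2 * w != 0)); first by rewrite mulf_neq0 ?expf_neq0.
  rewrite mulrACA [RHS]mulrACA -!numer_add_omega_denom //.
  rewrite -!numer_add_omega2_denom //; apply/eqP; rewrite -subr_eq0.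
  move/eqP: hND; rewrite -subr_eq0 => /eqP hND.
  set X := (X in X - _ == 0); set Y := (Y in _ - Y == 0).
  have -> : X - Y = (w ^+ 2 - w) * ((a * y + a + 1) * (b * z + z + 1)
     - (b * z + b + 1) * (a * y + y + 1)) by rewrite /X /Y; ring.
  by rewrite hND mulr0.
(* This is t(y)/t(z). *)
pose r := ((y + w) * (z + w ^+ 2)) / ((z + w) * (y + w ^+ 2)).
have r0 : r != 0 by rewrite !(mulf_neq0, invr_neq0).
(* The q-th power swaps the two linear factors of t up to scalars; the scalars cancel in [r]. *)
have phi_frob t : t ^+ (2 ^ m).+1 = 1 ->
    (t + w) ^+ (2 ^ m) = w * t^-1 * (t + w ^+ 2) /\
    (t + w ^+ 2) ^+ (2 ^ m) = w ^+ 2 * t^-1 * (t + w).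
  move=> tQ; have t0 := expfS_eq1_neq0 tQ.
  rewrite !exprDn_pchar2 // wm w2m (expfS_eq1_inv tQ).
  by split; rewrite -[X in X + _ = _]mul1r -w3; field.
have [Fy Fy2] := phi_frob y yQ; have [Fz Fz2] := phi_frob z zQ.
have y0 := expfS_eq1_neq0 yQ; have z0 := expfS_eq1_neq0 zQ.
have rV : r ^+ (2 ^ m) = r^-1.
  rewrite /r expr_div_n !exprMn Fy Fy2 Fz Fz2; field.
  by rewrite y0 z0 w0 Py Pz Py2 Pz2.
have /andP[aw aw2] : (a + w != 0) && (a + w ^+ 2 != 0).
  by apply: Pneq0; rewrite exprAC yQ expr1n.
have /andP[bw bw2] : (b + w != 0) && (b + w ^+ 2 != 0).
  by apply: Pneq0; rewrite exprAC zQ expr1n.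
(* For odd [k] the K-th power swaps [w] and [w ^+ 2], for even [k] it fixes them; [hPQ] then gives
   the value. *)
have rk : r ^+ (2 ^ k) = if odd k then r^-1 else r.
  rewrite /r expr_div_n !exprMn !exprDn_pchar2 // ![(w ^+ 2) ^+ _]exprAC.
  rewrite exp2n_omega // -/a -/b; case: (odd k) => /=; apply/eqP.
    have -> : (w ^+ 2) ^+ 2 = w by rewrite -exprM exprS w3 mulr1.
    rewrite invf_div eqr_div ?mulf_neq0 //; apply/eqP.
    by rewrite mulrACA hPQ; ring.
  rewrite eqr_div ?mulf_neq0 //; apply/eqP.
  transitivity (((b + w ^+ 2) * (z + w)) * ((a + w) * (y + w ^+ 2))).
    by ring.
  by rewrite -hPQ; ring.
suff r1 : r = 1.
  have /eqP : (y + w) * (z + w ^+ 2) = (z + w) * (y + w ^+ 2).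
    by rewrite -[RHS]mul1r -r1 divfK // mulf_neq0.
  (* The difference is (w^2 - w)(y - z), and w^2 - w = 1. *)
  rewrite -subr_eq0 => /eqP e; apply/eqP; rewrite -subr_eq0; apply/eqP.
  by rewrite -[RHS]e; ring: hw.
have [oddk|evk] := boolP (odd k).
  (* Raising to the power K twice fixes [r]; the valuation of [2 * k] is 1, at most that of the even
     [m]. *)
  apply: (@frobenius_fixed_inv_eq1 _ _ m (2 * k)) => //.
    by rewrite muln_gt0.
    rewrite lognM // (@lognE _ k) dvdn2 oddk andbF addn0 logn_prime //=.
    by rewrite logn_gt0 mem_primes m0 dvdn2 evm.
  by rewrite mul2n -addnn expnD exprM rk oddk exprVn rk oddk invrK.
apply: (@frobenius_fixed_inv_eq1 _ _ m k) => //.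
by rewrite rk (negPf evk).
Qed.

(** * The field of order [2 ^ (2 * m)] and exponents modulo [N] *)

Lemma exists_omega (F : finFieldType) (m : nat) :
  #|F| = (2 ^ (2 * m))%N -> (0 < m)%N -> exists w : F, w ^+ 2 + w + 1 = 0.
Proof.
move=> cardF m0; pose n := (2 ^ (2 * m)).-1.
have n0 : (0 < n)%N.
  by rewrite /n -ltnS prednK ?expn_gt0 // (ltn_exp2l 0) // muln_gt0.
have dvd3 : (3 %| n)%N.
  by rewrite /n expnM -subn1 -eqn_mod_dvd ?expn_gt0 // -modnXm exp1n.
have p0 : (0 < n %/ 3)%N by rewrite divn_gt0 // dvdn_leq.
suff [x x0 wn1] : exists2 x : F, x != 0 & x ^+ (n %/ 3) != 1.
  exists (x ^+ (n %/ 3)); set w := x ^+ _.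
  have /eqP : (w - 1) * (w ^+ 2 + w + 1) = 0.
    have -> : (w - 1) * (w ^+ 2 + w + 1) = w ^+ 3 - 1 by ring.
    apply/eqP; rewrite subr_eq0 -exprM divnK //; apply/eqP.
    apply: (mulfI x0); rewrite -exprS /n prednK ?expn_gt0 // -cardF.
    by rewrite expf_card mulr1.
  by rewrite mulf_eq0 subr_eq0 (negPf wn1) /= => /eqP.
(* Otherwise all [n] nonzero elements are roots of a polynomial of degree [n %/ 3]. *)
apply/exists_inP; apply: contraT => /exists_inPn hall.
pose rs := rem 0 (enum F).
have := @max_poly_roots F ('X^(n %/ 3) - 1) rs.
rewrite size_XnsubC // -size_poly_eq0 size_XnsubC //= rem_uniq ?enum_uniq //.
have -> : all (root ('X^(n %/ 3) - 1)) rs.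
  apply/allP=> x; rewrite mem_rem_uniq ?enum_uniq // inE => /andP[x0 _].
  by rewrite rootE !hornerE (eqP (negbNE (hall x x0))) subrr.
rewrite size_rem ?mem_enum // -cardE cardF -/n => /(_ isT isT isT).
by rewrite ltnS leqNgt ltn_Pdiv.
Qed.

(** No exponent reduces to 0, so each monomial vanishes at 0: otherwise [Q - 2], a divisor of [N],
    would divide [d] and hence 1, yet it is at least 3. *)
Lemma ndvdz_add_mul (m : nat) (d e : int) :
  let Q : int := 2 ^+ m + 1 in let N : int := 2 ^+ (2 * m) - 1 in
  (1 < m)%N -> gcdz d N = 1 -> ~~ (N %| d + (Q - 2) * e)%Z.
Proof.
move=> Q N m1 dN; apply/negP => Nd.
have NE : N = (Q - 2) * Q by rewrite /N /Q mulnC exprM; ring.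
have dv1 : (Q - 2 %| 1)%Z.
  rewrite -[X in (_ %| X)%Z]dN dvdz_gcd; apply/andP.
  split; last by rewrite NE dvdz_mulr.
  rewrite -[d](addrK ((Q - 2) * e)) rpredB ?dvdz_mulr //.
  by apply: dvdz_trans Nd; rewrite NE dvdz_mulr.
have q4 : 2 ^+ 2 <= 2 ^+ m :> int by rewrite ler_eXn2l.
by move: dv1; rewrite dvdz1 /Q; lia.
Qed.

Lemma horner_Xmod (F : finFieldType) (N d : int) (x : F) :
  0 < N -> x ^ N = 1 -> (Xmod F N d).[x] = x ^ d.
Proof.
move=> N0 xN; have x0 : x != 0.
  apply: contra_eq_neq xN => ->.
  by case: N N0 => [[|n]|n] // _; rewrite -exprnP expr0n eq_sym oner_eq0.
rewrite hornerXn exprnP gez0_abs ?modz_ge0 ?gt_eqF //.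
move: (d %/ N)%Z (d %% N)%Z (divz_eq d N) => c e ->.
by rewrite expfzDr // (mulrC c) -exprz_exp xN exp1rz mul1r.
Qed.

Lemma horner0_Xmod (F : finFieldType) (N d : int) :
  ~~ (N %| d)%Z -> (Xmod F N d).[0] = 0.
Proof.
by move=> Nd; rewrite hornerXn expr0n absz_eq0;
  case: eqP Nd => // /dvdz_mod0P ->.
Qed.

Theorem theorem2 (m k i : nat) (s u : int) (F : finFieldType)
  (hm0 : (0 < m)%N) (hm : ~~ odd m) (hk0 : (0 < k)%N) (hi0 : (0 < i)%N)
  (hF : #|F| = (2 ^ (2 * m))%N) :
  let Q : int := 2 ^+ m + 1 in
  let K : int := 2 ^+ k in
  let N : int := 2 ^+ (2 * m) - 1 in
  let d1 : int := (K + 2 * s + 1) * i%:Z + u * Q in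
  let d2 : int := (K + 2 * s + 1) * i%:Z + u * Q + (Q - 2) * i%:Z in
  let d3 : int := (K + 2 * s + 1) * i%:Z + u * Q + (Q - 2) * s * i%:Z in
  let d4 : int := (K + 2 * s + 1) * i%:Z + u * Q + (Q - 2) * (s + 1) * i%:Z in
  let d5 : int := (K + 2 * s + 1) * i%:Z + u * Q + (Q - 2) * (2 * s) * i%:Z in
  let d6 : int :=
    (K + 2 * s + 1) * i%:Z + u * Q + (Q - 2) * (2 * s + 1) * i%:Z in
  let d7 : int := (K + 2 * s + 1) * i%:Z + u * Q + (Q - 2) * (K + 1) * i%:Z in
  let d8 : int :=
    (K + 2 * s + 1) * i%:Z + u * Q + (Q - 2) * (K + s + 1) * i%:Z in
  let d9 : int :=
    (K + 2 * s + 1) * i%:Z + u * Q + (Q - 2) * (K + 2 * s + 1) * i%:Z in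
  (logn 2 k <= logn 2 m)%N ->
  gcdz i%:Z Q = 1 ->
  gcdz (K + 2 * s + 1) Q = 1 ->
  gcdz d1 N = 1 ->
  permutation_polynomial
    (Xmod F N d1 + Xmod F N d2 + Xmod F N d3 + Xmod F N d4 + Xmod F N d5
     + Xmod F N d6 + Xmod F N d7 + Xmod F N d8 + Xmod F N d9).
Proof.
move=> Q K N d1 d2 d3 d4 d5 d6 d7 d8 d9 vkm iQ _ d1N.
have m1 : (1 < m)%N by lia.
have ch2 : 2%N \in [pchar F] := card_finPcharP hF isT.
have [w /eqP hw] := exists_omega hF hm0.
have w2 : w ^+ 2 = w + 1.
  by apply/eqP; rewrite -subr_eq0 -[w + 1]oppr_pchar2 // opprK addrA.
have NE : N = (Q - 2) * Q by rewrite /N /Q mulnC exprM; ring.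
have N0 : 0 < N.
  by rewrite /N subr_gt0 exprn_egt1 // -lt0n muln_gt0.
have KE : K = (2 ^ k)%N by rewrite /K -natrX natz.
have QE : Q = (2 ^ m).+1 by rewrite /Q -natrX natz intS addrC.
have xN (x : F) : x != 0 -> x ^ N = 1.
  move=> x0; apply: (mulfI x0).
  rewrite -[x in x * _]expr1z -expfzDr // /N addrC subrK mulr1.
  by rewrite -natrX natz -exprnP -hF expf_card.
set f := (X in permutation_polynomial X).
(* The multipliers of [(Q - 2) * i] run through {0, 1, K+1} + {0, s, 2s}, whence the factorization
   into [D] and [T]. *)
have Ed :
  [/\ d2 = d1 + (Q - 2) * (1 * i%:Z),
   d3 = d1 + (Q - 2) * (s * i%:Z),
   d4 = d1 + (Q - 2) * ((s + 1) * i%:Z) &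
   d5 = d1 + (Q - 2) * ((s + s) * i%:Z)] /\
  [/\ d6 = d1 + (Q - 2) * ((s + s + 1) * i%:Z),
   d7 = d1 + (Q - 2) * ((K + 1) * i%:Z),
   d8 = d1 + (Q - 2) * ((K + s + 1) * i%:Z) &
   d9 = d1 + (Q - 2) * ((K + s + s + 1) * i%:Z)].
  rewrite /d2 /d3 /d4 /d5 /d6 /d7 /d8 /d9 /d1.
  by move: (Q) (K) => Q' K'; split; split; ring.
have f0 : f.[0] = 0.
  rewrite /f; have [[-> -> -> ->] [-> -> -> ->]] := Ed.
  have := ndvdz_add_mul 0 m1 d1N; rewrite mulr0 addr0 => Nd1.
  by rewrite !hornerD !horner0_Xmod ?ndvdz_add_mul // !addr0.
pose y x : F := x ^ ((Q - 2) * i%:Z).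
have yQ x : x != 0 -> y x ^+ (2 ^ m).+1 = 1.
  move=> x0; rewrite [LHS]exprnP -QE /y exprz_exp.
  by rewrite mulrAC -NE -exprz_exp xN // exp1rz.
pose D x := y x ^+ (2 ^ k) * y x + y x + 1.
pose M x := y x ^+ (2 ^ k) * y x + y x ^+ (2 ^ k) + 1.
pose T x := (y x ^ s) ^+ 2 + y x ^ s + 1.
have fE x : x != 0 -> f.[x] = x ^ d1 * (D x * T x).
  move=> x0; have y0 := expfS_eq1_neq0 (yQ x x0).
  have Xd e : (Xmod F N (d1 + (Q - 2) * (e * i%:Z))).[x] = x ^ d1 * y x ^ e.
    rewrite horner_Xmod ?xN // expfzDr // /y exprz_exp.
    by rewrite [e * _]mulrC mulrA.
  rewrite /f; have [[-> -> -> ->] [-> -> -> ->]] := Ed.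
  rewrite !hornerD !Xd horner_Xmod ?xN // !expfzDr // expr1z KE -exprnP /D /T.
  by ring.
have TQ x : x != 0 -> (y x ^ s) ^+ (2 ^ m).+1 = 1.
  by move=> x0; rewrite exprnP exprzAC -exprnP yQ // exp1rz.
have T0 x : x != 0 -> T x != 0 by move=> x0; apply: cyclotomic3_neq0 (TQ x x0).
have D0 x : x != 0 -> D x != 0 by move=> x0; apply: denom_neq0 (yQ x x0).
have f_neq0 x : x != 0 -> f.[x] != 0.
  by move=> x0; rewrite fE // !mulf_neq0 ?expfz_neq0 ?D0 ?T0.
(* The powers of [y x] produced by the three factors, with exponents K+1+2s, -(K+1) and -2s,
   cancel. *)
have fq x : x != 0 -> f.[x] ^+ (2 ^ m) = x ^ d1 * (M x * T x).
  move=> x0; have y0 := expfS_eq1_neq0 (yQ x x0).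
  have aQ : (y x ^+ (2 ^ k)) ^+ (2 ^ m).+1 = 1 by rewrite exprAC yQ // expr1n.
  have t0 := expfS_eq1_neq0 (TQ x x0).
  rewrite fE // !exprMn /D (numer_denom_frobenius ch2 aQ) ?yQ //.
  have -> : T x ^+ (2 ^ m) = (y x ^ s)^-1 ^+ 2 * T x.
    rewrite /T !exprDn_pchar2 // exprAC expr1n !(expfS_eq1_inv (TQ x x0)).
    by field.
  have -> : (x ^ d1) ^+ (2 ^ m) =
      x ^ d1 * (y x ^+ (2 ^ k) * y x * (y x ^ s) ^+ 2).
    rewrite [LHS]exprnP exprz_exp.
    have -> : d1 * (2 ^ m)%N = d1 + (Q - 2) * i%:Z * (K + 1 + (s + s)) + N * u.
      have -> : (2 ^ m)%N = Q - 1 :> int by rewrite /Q -natrX natz addrK.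
      by rewrite NE /d1; move: (Q) (K) => Q' K'; ring.
    rewrite !expfzDr // -[x ^ (N * u)]exprz_exp xN // exp1rz mulr1.
    congr (_ * _).
    by rewrite -exprz_exp -/(y x) !expfzDr // expr1z KE -exprnP expr2.
  rewrite -/(M x); move: (M x) (T x) (x ^ d1) t0 y0 (expfS_eq1_neq0 aQ).
  move: (y x ^+ (2 ^ k)) (y x ^ s) (y x) => a t z M' T' X t0 z0 a0.
  by field; rewrite t0 z0 a0.
apply: injF_bij => x x' /=.
have [->|x0] := eqVneq x 0; have [->|x'0] := eqVneq x' 0 => //.
- by move=> e; have := f_neq0 x' x'0; rewrite -e f0 eqxx.
- by move=> e; have := f_neq0 x x0; rewrite e f0 eqxx.
move=> e.
(* M/D is f^(q-1), so equal values of [f] give equal fractions. *)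
have fD z : z != 0 -> f.[z] ^+ (2 ^ m) * D z = f.[z] * M z.
  by move=> z0; rewrite fq // fE //; ring.
have yy' : y x = y x'.
  apply: (@numer_denom_inj _ w _ _ m k) => //; rewrite ?yQ //.
  apply: (mulfI (f_neq0 x x0)).
  by rewrite mulrA -fD // [in RHS]e mulrA -fD // e; rewrite /D; ring.
(* Both sides have equal [i]-th powers by [yy'], and [Q]-th power 1. *)
have vv' : x ^ (Q - 2) = x' ^ (Q - 2).
  apply: (expfz_gcd_inj _ _ iQ); rewrite ?expfz_neq0 ?exprz_exp //.
  by rewrite -NE !xN.
apply: (expfz_gcd_inj x0 x'0 d1N); last by rewrite !xN.
(* [D] and [T] depend only on [y x], so they cancel and leave equal [d1]-th powers. *)
apply: (mulIf (_ : D x * T x != 0)); first by rewrite mulf_neq0 ?D0 ?T0.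
by rewrite -fE // e fE // /D /T yy'.
Qed.
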